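(* Let $M<N$ be positive integers and let $K\in\{1,\dots,M-1\}$ be arbitrary. Let $\mathcal A_K$ be the set of all matrices $A\in\mathbb{R}^{M\times N}$ satisfying the following property (H1 for $K$): for every $r\in\{1,\dots,K\}$ and all $\omega,\varpi\in\Omega_r$ with $\omega\ne\varpi$, one has $\Pi_\omega\neq\Pi_\varpi$. Then $\mathcal A_K$ contains an open and dense subset of the space $\mathbb{R}^{M\times N}$ of all $M\times N$ real matrices.
   Context: For $A\in\mathbb{R}^{M\times N}$ and $\omega\subseteq\{1,\dots,N\}$, $A_\omega\in\mathbb{R}^{M\times\#\omega}$ is the submatrix of $A$ formed by the columns indexed by $\omega$ (in increasing order). For $r\in\{1,\dots,M\}$, $\Omega_r=\Omega_r(A)=\{\omega\subset\{1,\dots,N\}:\#\omega=r=\operatorname{rank}(A_\omega)\}$. For $\omega\in\Omega_r$, $\Pi_\omega=A_\omega(A_\omega^TA_\omega)^{-1}A_\omega^T\in\mathbb{R}^{M\times M}$ is the orthogonal projector onto the range of $A_\omega$. *)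

(* Defs.v *)
From HB Require Import structures.
From mathcomp Require Import all_boot all_order all_algebra.
From mathcomp Require Import all_classical all_reals all_analysis.

Set Implicit Arguments.
Unset Strict Implicit.
Unset Printing Implicit Defensive.

Import Order.TTheory GRing.Theory Num.Theory.
Import numFieldNormedType.Exports.

Local Open Scope classical_set_scope.
Local Open Scope ring_scope.

(* [enum_val] lists the elements of [w] in the order of [enum 'I_N], that is,
   in increasing order. *)
Definition colset (R : realType) (M N : nat) (A : 'M[R]_(M, N))
    (w : {set 'I_N}) : 'M[R]_(M, #|w|) :=
  colsub (fun j : 'I_#|w| => enum_val j) A.

Definition Omega (R : realType) (M N : nat) (A : 'M[R]_(M, N)) (r : nat) :
    {set {set 'I_N}} :=
  [set w : {set 'I_N} | (#|w| == r) && (\rank (colset A w) == r)]%SET.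

(* [invmx] is the true inverse only when the columns of [colset A w] are
   linearly independent, which holds for every [w] in [Omega A r]. *)
Definition Proj (R : realType) (M N : nat) (A : 'M[R]_(M, N))
    (w : {set 'I_N}) : 'M[R]_M :=
  colset A w *m invmx ((colset A w)^T *m colset A w) *m (colset A w)^T.

Definition H1 (R : realType) (M N : nat) (K : nat) (A : 'M[R]_(M, N)) : Prop :=
  forall r : nat, (1 <= r <= K)%N ->
  forall w v : {set 'I_N}, w \in Omega A r -> v \in Omega A r -> w <> v ->
  Proj A w <> Proj A v.

(* Main.v *)
(* Call A generic if all its maximal (M x M) minors are nonzero. Genericity is
   the non-vanishing of a polynomial in the entries of A, so it is an open
   condition. It holds for a Vandermonde matrix B, so on the line through A and B
   the polynomial has only finitely many zeros, and generic matrices are dense.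
   If two distinct sets w and v of r < M columns span the same space, a column
   indexed by j in v \ w is a combination of those in w, so the r + 1 <= M
   columns indexed by w and j are dependent; completing them to M columns gives
   a vanishing maximal minor. *)
Require Import Defs.
From HB Require Import structures.
From mathcomp Require Import all_boot all_order all_algebra.
From mathcomp Require Import all_classical all_reals all_analysis.

Set Implicit Arguments.
Unset Strict Implicit.
Unset Printing Implicit Defensive.

Import Order.TTheory GRing.Theory Num.Theory.
Import numFieldNormedType.Exports.

Local Open Scope classical_set_scope.
Local Open Scope ring_scope.

Lemma exists_superset_card (T : finType) (A : {set T}) (m : nat) :
  (#|A| <= m <= #|T|)%N -> exists2 B : {set T}, A \subset B & #|B| = m.
Proof.
elim: m => [|m IHm] /andP[]; first by rewrite leqn0 => /eqP A0; exists A.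
rewrite leq_eqVlt ltnS => /orP[/eqP Am|Am] mT; first by exists A.
have [|B AB Bm] := IHm; first by rewrite Am ltnW.
have [x xB] : exists x, x \in ~: B.
  by apply/card_gt0P; rewrite cardsCs finset.setCK Bm subn_gt0.
exists (x |: B); first exact: fintype.subset_trans AB (finset.subsetUr _ _).
by rewrite cardsU1 Bm -finset.in_setC xB.
Qed.

Lemma mulmx_trmx_eq0 (R : realDomainType) (m n : nat) (A : 'M[R]_(m, n)) :
  A *m A^T = 0 -> A = 0.
Proof.
move=> AAT0; apply/matrixP => i j; rewrite mxE; apply/eqP.
have /eqP : (A *m A^T) i i = 0 by rewrite AAT0 mxE.
rewrite mxE psumr_eq0 => [/allP/(_ j)|k _]; last by rewrite mxE -expr2 sqr_ge0.
by rewrite mem_index_enum mxE mulf_eq0 orbb; apply.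
Qed.

(** If [k *m A^T *m A = 0], then [k *m A^T] times its own transpose is 0. Over an ordered field this
    forces [k *m A^T = 0], and [k = 0] follows because the columns of [A] are independent. *)
Lemma gram_unitmx (R : realFieldType) (m n : nat) (A : 'M[R]_(m, n)) :
  \rank A = n -> A^T *m A \in unitmx.
Proof.
move=> rankA; have freeAT : row_free A^T by rewrite /row_free mxrank_tr rankA.
rewrite -row_free_unit -kermx_eq0; set k := kermx _.
have kAAT0 : k *m A^T = 0.
  apply: mulmx_trmx_eq0.
  by rewrite trmx_mul trmxK mulmxA -(mulmxA k) mulmx_ker mul0mx.
by rewrite -(mulmx_free_eq0 k freeAT) kAAT0.
Qed.

Lemma Proj_colset (R : realType) (M N r : nat) (A : 'M[R]_(M, N))
    (w : {set 'I_N}) :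
  w \in Omega A r -> Proj A w *m colset A w = colset A w.
Proof.
rewrite inE => /andP[/eqP <- /eqP rankw].
by rewrite /Proj -!mulmxA mulVmx ?mulmx1 ?gram_unitmx.
Qed.

(** Since [y] vanishes off the image of [f], restricting it along [f] loses nothing and gives a
    nonzero kernel vector of the square submatrix. *)
Lemma det_colsub_eq0 (R : fieldType) (M N : nat) (A : 'M[R]_(M, N))
    (y : 'cV[R]_N) (f : 'I_M -> 'I_N) :
  injective f -> (forall k, y k 0 != 0 -> k \in codom f) ->
  A *m y = 0 -> y != 0 -> \det (colsub f A) = 0.
Proof.
move=> f_inj ysupp Ay0 y0; apply/eqP; rewrite -det_tr; apply/det0P.
exists (\row_i y (f i) 0).
  apply: contraNneq y0 => z0; apply/eqP/colP => k; rewrite mxE.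
  have [//|/ysupp/codomP[i ->]] := eqVneq (y k 0) 0.
  by have /rowP/(_ i) := z0; rewrite !mxE.
apply/rowP => i; rewrite !mxE.
have /colP/(_ i) := Ay0; rewrite !mxE => {2}<-.
rewrite [RHS](bigID [in f @: 'I_M]) /= [X in _ + X]big1 ?addr0.
  rewrite big_imset /=; last by move=> ? ? _ _; exact: f_inj.
  by apply: eq_bigr => k _; rewrite !mxE mulrC.
move=> k; apply: contraNeq; rewrite mulf_eq0 negb_or => /andP[_ /ysupp].
by case/codomP => l ->; rewrite imset_f.
Qed.

(** Each choice of M columns occurs once per ordering, which changes its minor only by a sign and so
    does not affect vanishing. The general ring allows matrices of polynomials. *)
Definition maximal_minors_prod (R : comPzRingType) (M N : nat)
    (A : 'M[R]_(M, N)) : R :=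
  \prod_(f : {ffun 'I_M -> 'I_N} | injectiveb f) \det (colsub f A).

Lemma maximal_minors_prod_neq0P (R : idomainType) (M N : nat)
    (A : 'M[R]_(M, N)) :
  reflect (forall f : 'I_M -> 'I_N, injective f -> \det (colsub f A) != 0)
    (maximal_minors_prod A != 0).
Proof.
rewrite /maximal_minors_prod.
apply: (iffP (prodf_neq0 _ _)) => [A0 f f_inj|A0 f /injectiveP/A0//].
have ff : finfun f =1 f by exact: ffunE.
have /A0 : injectiveb (finfun f) by apply/injectiveP/(eq_inj f_inj) => i.
by rewrite (eq_colsub _ ff).
Qed.

Lemma colsub_Vandermonde (R : pzRingType) (m n p : nat) (a : 'rV[R]_n)
    (f : 'I_p -> 'I_n) :
  colsub f (Vandermonde m a) = Vandermonde m (colsub f a).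
Proof. by apply/matrixP => i j; rewrite !mxE. Qed.

(** Selecting columns leaves a Vandermonde matrix with distinct nodes. *)
Lemma maximal_minors_prod_Vandermonde_neq0 (R : numDomainType) (M N : nat) :
  maximal_minors_prod (Vandermonde M (\row_(j < N) j%:R : 'rV[R]_N)) != 0.
Proof.
apply/maximal_minors_prod_neq0P => f f_inj.
rewrite colsub_Vandermonde det_Vandermonde.
apply/prodf_neq0 => i _; apply/prodf_neq0 => j ij; rewrite !mxE subr_eq0.
by rewrite eqr_nat (inj_eq val_inj) (inj_eq f_inj) -(inj_eq val_inj) gtn_eqF.
Qed.

Lemma rmorph_maximal_minors_prod (R S : comNzRingType) (h : {rmorphism R -> S})
    (M N : nat) (A : 'M[R]_(M, N)) :
  h (maximal_minors_prod A) = maximal_minors_prod (map_mx h A).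
Proof.
by rewrite rmorph_prod; apply: eq_bigr => f _; rewrite -map_mxsub det_map_mx.
Qed.

Lemma continuous_maximal_minors_prod (R : realType) (M N : nat) :
  continuous (@maximal_minors_prod R M N).
Proof.
apply: (continuous_big (@mul_continuous R)) => f _.
apply: (continuous_big (@add_continuous R)) => s _.
move=> A; apply: cvgMl_tmp; first exact: nbhs_filter.
apply: (cvg_big (@mul_continuous R)) => [|i _]; first exact: nbhs_filter.
by rewrite mxE; under eq_fun do rewrite mxE; exact: coord_continuous.
Qed.

Lemma exists_small_nonroot (R : realFieldType) (p : {poly R}) (e : R) :
  p != 0 -> 0 < e -> exists2 t, `|t| < e & ~~ root p t.
Proof.
(* These are [size p] distinct points, more than [p] can have roots; denominators start at 2 so that
   each point is strictly below [e]. *)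
move=> p0 e0; pose s := [seq e / i.+2%:R | i <- iota 0 (size p)].
have s_uniq : uniq s.
  rewrite map_inj_uniq ?iota_uniq // => i j.
  move=> /(mulfI (lt0r_neq0 e0))/invr_inj/eqP.
  by rewrite eqr_nat => /eqP[].
have /allPn[t /mapP[i _ ->] rt] : ~~ all (root p) s.
  apply/negP => sp; have := max_poly_roots p0 sp s_uniq.
  by rewrite size_map size_iota ltnn.
exists (e / i.+2%:R) => //.
by rewrite ger0_norm ?divr_ge0 ?ltW // ltr_pdivrMr // ltr_pMr // ltr1n.
Qed.

Lemma dense_maximal_minors_prod_neq0 (R : realType) (M N : nat) :
  dense [set A : 'M[R]_(M, N) | maximal_minors_prod A != 0].
Proof.
move=> O [A OA] Oopen.
pose D := Vandermonde M (\row_(j < N) j%:R : 'rV[R]_N) - A.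
(* The restriction of the product of minors to the line [A + t *: D], as a polynomial in [t]; at
   [t = 1] the line meets the Vandermonde matrix. *)
pose p := maximal_minors_prod (map_mx polyC A + 'X *: map_mx polyC D).
have pE t : p.[t] = maximal_minors_prod (A + t *: D).
  rewrite -horner_evalE rmorph_maximal_minors_prod; congr maximal_minors_prod.
  by apply/matrixP => i j; rewrite !mxE /= horner_evalE !hornerE.
have p0 : p != 0.
  apply: contraTneq (maximal_minors_prod_Vandermonde_neq0 R M N) => p0.
  have := pE 1; rewrite p0 horner0 scale1r /D addrC subrK => <-.
  by rewrite eqxx.
have line_cvg : (A + t *: D) @[t --> (0 : R)] --> A.
  rewrite -[X in _ --> X]addr0 -[X in _ --> A + X](scale0r D).
  apply: cvgD; first exact: cvg_cst.
  exact: scalel_continuous.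
have /nbhs_ballP[e /= e0 eO] : nbhs (0 : R) ((fun t => A + t *: D) @^-1` O).
  by apply: line_cvg; exact: open_nbhs_nbhs.
have [t te rt] := exists_small_nonroot p0 e0.
exists (A + t *: D); split; last by rewrite /= -pE.
by apply: eO; rewrite /ball /= sub0r normrN.
Qed.

Lemma eq_Proj_maximal_minors_prod (R : realType) (M N r : nat)
    (A : 'M[R]_(M, N)) (w v : {set 'I_N}) :
  (r < M <= N)%N -> w \in Omega A r -> v \in Omega A r -> w != v ->
  Proj A w = Proj A v -> maximal_minors_prod A = 0.
Proof.
move=> /andP[rM MN] wO vO wv Pwv.
move: (wO) (vO); rewrite !inE => /andP[/eqP wr _] /andP[/eqP vr _].
have /subsetPn[j jv jw] : ~~ (v \subset w).
  by apply: contra wv => vw; rewrite eq_sym eqEcard vw wr vr leqnn.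
have [|S jwS SM] := @exists_superset_card _ (j |: w) M.
  by rewrite cardsU1 jw wr card_ord rM.
(* [y] holds the coefficients of a linear relation among the columns of [A]
   indexed by [j |: w]. *)
pose c := invmx ((colset A w)^T *m colset A w) *m (colset A w)^T *m col j A.
(* [Proj A v] fixes column [j], as [j] lies in [v]; hence so does [Proj A w]. *)
have colj : col j A = colset A w *m c.
  rewrite /c !mulmxA -/(Proj A w) Pwv; apply/esym.
  have -> : col j A = col (enum_rank_in jv j) (colset A v).
    by apply/colP => i; rewrite !mxE enum_rankK_in.
  by rewrite colE mulmxA (Proj_colset vO).
(* [E] extends a vector indexed by [w] by zero, and [A *m E] is [colset A w]. *)
pose E : 'M[R]_(N, #|w|) := colsub (fun k => enum_val k) 1%:M.
have Eout k : k \notin w -> (E *m c) k 0 = 0.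
  move=> kw; rewrite mxE big1 // => l _; rewrite !mxE.
  by case: eqP kw => [->|_]; rewrite ?enum_valP // mul0r.
pose y : 'cV[R]_N := delta_mx j 0 - E *m c.
pose f (i : 'I_M) : 'I_N := enum_val (cast_ord (esym SM) i).
have f_inj : injective f by move=> i k /enum_val_inj/cast_ord_inj.
apply/eqP; rewrite -[_ == _]negbK; apply/negP.
move/maximal_minors_prod_neq0P/(_ _ f_inj)/eqP; apply.
apply: (@det_colsub_eq0 _ _ _ A y f) => //.
- move=> k yk; have kS : k \in S.
    apply: (fintype.subsetP jwS); rewrite !inE; apply: contraNT yk.
    rewrite negb_or => /andP[kj kw].
    by rewrite mxE [X in _ + X]mxE Eout // oppr0 addr0 mxE (negPf kj).
  apply/codomP; exists (cast_ord SM (enum_rank_in kS k)).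
  by rewrite /f cast_ordK enum_rankK_in.
- by rewrite mulmxBr -colE mulmxA mulmx_colsub mulmx1 colj subrr.
(* Entry [j] of [y] is 1, because [j] is not in [w]. *)
- apply: contraTneq isT => /colP/(_ j); rewrite mxE [X in _ + X]mxE Eout //.
  by rewrite !mxE !eqxx oppr0 addr0 => /eqP; rewrite oner_eq0.
Qed.

Theorem theorem5p3 (R : realType) (M N K : nat)
    (hM : (0 < M)%N) (hMN : (M < N)%N) (hK : (1 <= K <= M - 1)%N) :
  exists U : set 'M[R]_(M, N),
    [/\ open U, dense U & U `<=` [set A : 'M[R]_(M, N) | H1 K A]].
Proof.
exists [set A | maximal_minors_prod A != 0]; split.
- apply: (@open_comp _ _ (@maximal_minors_prod R M N) [set x | x != 0]).
    by move=> A _; exact: continuous_maximal_minors_prod.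
  exact: open_neq.
- exact: dense_maximal_minors_prod_neq0.
- move=> A /= A0 r /andP[_ rK] w v wO vO /eqP wv Pwv.
  move: A0; rewrite (eq_Proj_maximal_minors_prod _ wO vO wv Pwv) ?eqxx //.
  rewrite (ltnW hMN) andbT (leq_ltn_trans rK) //.
  (* Subtraction is truncated, so [M - 1 < M] relies on [0 < M]. *)
  by case/andP: hK => _ /leq_ltn_trans; apply; rewrite subn1 prednK.
Qed.
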